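(* Let $q$ be a prime power. If $C$ is a self-complementary code over $\mathbb{F}_q$ of length $n$ and strength 2, then $$\rho(C)\leq \frac{(q-1)}{q}n-\frac{\sqrt{n}}{q}.$$
   Context: A code over $\mathbb{F}_q$ of length $n$ is a nonempty subset $C\subset\mathbb{F}_q^n$ (not necessarily linear). The weight $|x|$ of $x\in\mathbb{F}_q^n$ is its number of nonzero coordinates. The covering radius of $C$ is $\rho(C)=\max_{x\in\mathbb{F}_q^n}\min_{c\in C}|x-c|$. The code $C$ is self-complementary if for all $c\in C$ and all $\omega\in\mathbb{F}_q$, the word $\overline{c}^{\omega}=(\omega,\ldots,\omega)+c$ belongs to $C$. The code $C$ has strength $s$ (where $s\le n$) if for each set of $s$ coordinate positions, the projections of the codewords of $C$ to these positions take each value of $\mathbb{F}_q^s$ the same number of times (counted over the codewords of $C$). *)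

(* Defs.v *)
From HB Require Import structures.
From mathcomp Require Import all_boot all_order all_algebra.

Set Implicit Arguments.
Unset Strict Implicit.
Unset Printing Implicit Defensive.

Import Order.TTheory GRing.Theory Num.Theory.
Local Open Scope ring_scope.

Definition weight (F : finFieldType) (n : nat) (x : 'rV[F]_n) : nat :=
  #|[set i : 'I_n | x 0 i != 0]|.

(* Weights are at most n, so the neutral element n does not affect the minimum
   when C is nonempty. *)
Definition dist_to_code (F : finFieldType) (n : nat)
    (C : {set 'rV[F]_n}) (x : 'rV[F]_n) : nat :=
  \big[minn/n]_(c in C) weight (x - c).

Definition covering_radius (F : finFieldType) (n : nat)
    (C : {set 'rV[F]_n}) : nat :=
  (\max_(x : 'rV[F]_n) dist_to_code C x)%N.

Definition self_complementary (F : finFieldType) (n : nat)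
    (C : {set 'rV[F]_n}) : Prop :=
  forall (c : 'rV[F]_n) (w : F), c \in C -> const_mx w + c \in C.

(* The columns of the projection follow the increasing enumeration of S. *)
Definition proj_on (F : finFieldType) (n : nat) (S : {set 'I_n})
    (c : 'rV[F]_n) : 'rV[F]_#|S| :=
  colsub (fun k : 'I_#|S| => enum_val k) c.

Definition has_strength (F : finFieldType) (n : nat)
    (C : {set 'rV[F]_n}) (s : nat) : Prop :=
  (s <= n)%N /\
  forall S : {set 'I_n}, #|S| = s ->
    forall u v : 'rV[F]_#|S|,
      #|[set c in C | proj_on S c == u]| = #|[set c in C | proj_on S c == v]|.

(* Main.v *)
Require Import Defs.
From HB Require Import structures.
From mathcomp Require Import all_boot all_order all_algebra.
From mathcomp Require Import ring lra.

Set Implicit Arguments.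
Unset Strict Implicit.
Unset Printing Implicit Defensive.

Import Order.TTheory GRing.Theory Num.Theory.
Local Open Scope ring_scope.

(** Second moment argument.  Fix a word [x] at distance [r] from [C], and put
    [M = n - r].  For a codeword [c] let [A_w(c)] be the number of coordinates
    where [x - c] takes the value [w].  The translates [c + (w, ..., w)] are
    codewords too, and the one for [w] agrees with [x] in [A_w(c)] places, so
    [A_w(c) <= M] for every [w]: no symbol is frequent in [x - c].

    The [q] numbers [M - A_w(c)] are thus nonnegative with sum [q M - n], and
    their squares add up to at most [(q M - n)^2] ([sum_gap_sqr_le]).  On the
    other hand [\sum_w A_w(c)^2] counts the ordered pairs of coordinates where
    [x - c] takes equal values ([sum_sqr_symbol_count]); as two distinct
    coordinates of a random codeword are independent and uniform, such a pair
    agrees with probability [1/q], so the mean over [C] of this sum is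
    [n + n (n - 1) / q] ([sum_code_sqr_symbol_count]).  Averaging the bound
    [\sum_w (M - A_w(c))^2 <= (q M - n)^2] over [C] and simplifying gives
    [n <= (q M - n)^2], that is [M >= (n + sqrt n) / q], which is the claim
    since [r = n - M]. *)

Definition symbol_count (F : finFieldType) (n : nat) (y : 'rV[F]_n) (w : F) :
    nat := #|[set i : 'I_n | y 0 i == w]|.

(** * Symbol frequencies of a single word *)

Lemma symbol_countE (F : finFieldType) (n : nat) (y : 'rV[F]_n) (w : F) :
  symbol_count y w = (\sum_(i < n) (y 0%R i == w))%N.
Proof.
rewrite /symbol_count -sum1_card [RHS]big_mkcond [LHS]big_mkcond /=.
by apply: eq_bigr => i _; rewrite inE; case: eqP.
Qed.

Lemma sum_symbol_count (F : finFieldType) (n : nat) (y : 'rV[F]_n) :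
  (\sum_(w : F) symbol_count y w)%N = n.
Proof.
under eq_bigr => w _ do rewrite symbol_countE.
rewrite exchange_big /= -[RHS]card_ord -sum1_card; apply: eq_bigr => i _.
rewrite (bigD1 (y 0 i)) //= eqxx big1 // => w /negbTE.
by rewrite eq_sym => ->.
Qed.

Lemma weight_sub_const (F : finFieldType) (n : nat) (y : 'rV[F]_n) (w : F) :
  (weight (y - const_mx w) + symbol_count y w)%N = n.
Proof.
rewrite -[RHS]card_ord -(cardC [set i | y 0 i == w]) addnC; congr (_ + _)%N.
by apply: eq_card => i; rewrite !inE !mxE subr_eq0.
Qed.

(** Both sides count the ordered pairs of coordinates carrying the same
    symbol; the left-hand side sorts them by that symbol. *)
Lemma sum_sqr_symbol_count (F : finFieldType) (n : nat) (y : 'rV[F]_n) :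
  (\sum_(w : F) symbol_count y w ^ 2 =
   \sum_(i < n) \sum_(j < n) (y 0%R i == y 0%R j))%N.
Proof.
transitivity (\sum_(w : F) \sum_(i < n) \sum_(j < n)
    (y 0%R i == w) * (y 0%R j == w))%N.
  apply: eq_bigr => w _; rewrite symbol_countE -mulnn big_distrl /=.
  by apply: eq_bigr => i _; rewrite big_distrr.
rewrite exchange_big; apply: eq_bigr => i _.
rewrite exchange_big; apply: eq_bigr => j _ /=.
rewrite (bigD1 (y 0 i)) //= eqxx mul1n big1 ?addn0 1?eq_sym // => w /negbTE.
by rewrite eq_sym => ->.
Qed.

(** For nonnegative numbers the sum of the squares is at most the square of
    the sum; the sum of the gaps [M - A_w] is [q M - n]. *)
Lemma sum_gap_sqr_le (R : realDomainType) (F : finFieldType) (n : nat)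
    (y : 'rV[F]_n) (M : R) :
  (forall w, (symbol_count y w)%:R <= M) ->
  \sum_(w : F) (M - (symbol_count y w)%:R) ^+ 2 <= (#|F|%:R * M - n%:R) ^+ 2.
Proof.
move=> leM; set e := fun w => M - (symbol_count y w)%:R.
have e_ge0 w : 0 <= e w by rewrite subr_ge0.
have -> : #|F|%:R * M - n%:R = \sum_w e w.
  by rewrite sumrB sumr_const mulr_natl -natr_sum sum_symbol_count.
rewrite [leRHS]expr2 mulr_suml; apply: ler_sum => w _.
rewrite -/(e w) expr2; apply: ler_wpM2l => //.
by rewrite [leRHS](bigD1 w) //= lerDl; apply: sumr_ge0.
Qed.

(** * Pairs of coordinates in a code of strength 2 *)

(** The difference of two coordinates of a random codeword is uniform.  Adding
    [a] to one of them permutes the possible projections to these coordinates,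
    which are all equally frequent, so every value of the difference is taken
    as often as the value [0]. *)
Lemma card_coord_diff (F : finFieldType) (n : nat) (C : {set 'rV[F]_n})
    (i j : 'I_n) (a : F) :
  has_strength C 2 -> i != j ->
  (#|F| * #|[set c in C | (c 0 i - c 0 j)%R == a]| = #|C|)%N.
Proof.
move=> [_ strC] ij; pose S := [set i; j].
have Si : i \in S by rewrite !inE eqxx.
have Sj : j \in S by rewrite !inE eqxx orbT.
have cardS : #|S| = 2%N by rewrite cards2 ij.
pose ki := enum_rank_in Si i; pose kj := enum_rank_in Si j.
have kiE : enum_val ki = i by rewrite enum_rankK_in.
have kjE : enum_val kj = j by rewrite enum_rankK_in.
have kij : kj == ki = false.
  by apply/negbTE; apply: contra_neq ij => kji; rewrite -kiE -kjE kji.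
pose T b := #|[set c in C | c 0 i - c 0 j == b]|.
have TE b : T b = (\sum_(u : 'rV[F]_#|S| | (u 0 ki - u 0 kj)%R == b)
    #|[set c in C | proj_on S c == u]|)%N.
  rewrite /T -sum1_card (partition_big (proj_on S)
    (fun u : 'rV_#|S| => u 0 ki - u 0 kj == b)) /=; last first.
    by move=> c; rewrite !inE !mxE kiE kjE => /andP[].
  apply: eq_bigr => u ub; rewrite -[RHS]sum1_card; apply: eq_bigl => c.
  rewrite !inE; case: (c \in C) => //=.
  case: (proj_on S c =P u) => [cu|]; rewrite ?andbF // andbT.
  by move: ub; rewrite -cu !mxE kiE kjE.
have TT b : T b = T 0.
  rewrite !TE (reindex_inj (addrI (b *: delta_mx 0 ki))) /=.
  apply: eq_big => [u|u _]; last exact: strC.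
  by rewrite !mxE !eqxx kij /= mulr1 mulr0 add0r -addrA -subr_eq0 addrAC subrr
    add0r.
rewrite -/(T a) TT.
have -> : #|C| = (\sum_(b : F) T b)%N.
  rewrite -sum1_card (partition_big (fun c : 'rV_n => c 0 i - c 0 j) xpredT) //.
  by apply: eq_bigr => b _; rewrite /T -sum1_card; apply: eq_bigl => c; rewrite inE.
by rewrite (eq_bigr _ (fun b _ => TT b)) sum_nat_const.
Qed.

(** The mean of [\sum_w A_w(c)^2] is [n + n (n - 1) / q]: the [n] diagonal pairs
    always agree, each of the others for a fraction [1/q] of the codewords. *)
Lemma sum_code_sqr_symbol_count (F : finFieldType) (n : nat)
    (C : {set 'rV[F]_n}) (x : 'rV[F]_n) :
  has_strength C 2 ->
  (#|F| * \sum_(c in C) \sum_(w : F) symbol_count (x - c)%R w ^ 2 =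
   #|C| * (n * (#|F| + n.-1)))%N.
Proof.
move=> strC.
under eq_bigr => c _ do rewrite sum_sqr_symbol_count.
rewrite exchange_big /= big_distrr /=.
rewrite (eq_bigr (fun=> #|C| * (#|F| + n.-1))%N); last first.
  move=> i _; rewrite exchange_big /= big_distrr /= (bigD1 i) //=.
  rewrite (eq_bigr (fun=> 1%N)); last by move=> c _; rewrite eqxx.
  rewrite sum1_card mulnDr mulnC; congr (_ + _)%N.
  rewrite (eq_bigr (fun=> #|C|)).
    by rewrite sum_nat_const cardC1 card_ord mulnC.
  move=> j ji; rewrite -(card_coord_diff (i := i) (j := j) (x 0 i - x 0 j) strC);
    last by rewrite eq_sym.
  congr (_ * _)%N; rewrite -sum1_card big_mkcond [RHS]big_mkcond /=.
  apply: eq_bigr => c _; rewrite inE !mxE; case: (c \in C) => //=.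
  rewrite -subr_eq0 -[in RHS]subr_eq0 -[in RHS]oppr_eq0.
  have -> : x 0 i - c 0 i - (x 0 j - c 0 j) =
    - (c 0 i - c 0 j - (x 0 i - x 0 j)) by ring.
  by case: eqP.
by rewrite sum_nat_const card_ord mulnCA.
Qed.

(** * The distance of a word to the code *)

Lemma dist_to_code_le (F : finFieldType) (n : nat) (C : {set 'rV[F]_n})
    (x c : 'rV[F]_n) :
  c \in C -> (dist_to_code C x <= weight (x - c))%N.
Proof.
move=> cC; rewrite /dist_to_code.
elim: index_enum (mem_index_enum c) => //= d s IHs.
rewrite inE big_cons => /predU1P[<-|/IHs le_s]; first by rewrite cC geq_minl.
by case: ifP => // _; rewrite geq_min le_s orbT.
Qed.

Lemma symbol_count_le_codist (F : finFieldType) (n : nat) (C : {set 'rV[F]_n})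
    (x c : 'rV[F]_n) (w : F) :
  self_complementary C -> c \in C ->
  (symbol_count (x - c) w + dist_to_code C x <= n)%N.
Proof.
move=> scC cC; rewrite -[leqRHS](weight_sub_const (x - c) w) addnC leq_add2r.
by rewrite -addrA -opprD [c + _]addrC; apply/dist_to_code_le/scC.
Qed.

(** No [A_w] exceeds [M], which bounds the squared gaps of every codeword from
    above, while their mean over [C] is known exactly.  The nonnegativity of
    [q M - n], a sum of [q] gaps, is what allows a square root to be taken. *)
Lemma length_le_sqr_codist (R : realDomainType) (F : finFieldType) (n : nat)
    (C : {set 'rV[F]_n}) (x : 'rV[F]_n) (M : R) :
  C != set0 -> self_complementary C -> has_strength C 2 ->
  M = n%:R - (dist_to_code C x)%:R ->
  0 <= #|F|%:R * M - n%:R /\ n%:R <= (#|F|%:R * M - n%:R) ^+ 2.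
Proof.
move=> C0 scC strC defM.
have leM c w : c \in C -> (symbol_count (x - c) w)%:R <= M.
  move=> cC; rewrite defM lerBrDr -natrD ler_nat.
  exact: symbol_count_le_codist.
split.
  have /set0Pn[c cC] := C0.
  rewrite subr_ge0 -[X in X%:R <= _](sum_symbol_count (x - c)) natr_sum.
  rewrite mulr_natl -sumr_const; apply: ler_sum => w _; exact: leM.
set q : R := #|F|%:R.
pose Q (c : 'rV[F]_n) : R := (\sum_(w : F) symbol_count (x - c)%R w ^ 2)%:R.
have gapE c : \sum_(w : F) (M - (symbol_count (x - c) w)%:R) ^+ 2 =
    q * M ^+ 2 - 2 * M * n%:R + Q c.
  rewrite -[X in 2 * M * X%:R](sum_symbol_count (x - c)) /Q !natr_sum.
  rewrite mulr_sumr /q mulr_natl -sumr_const -sumrB -big_split /=.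
  by apply: eq_bigr => w _; rewrite natrX; ring.
have sumQ : q * \sum_(c in C) Q c = #|C|%:R * (n%:R * (q + n%:R - 1)).
  rewrite /Q -natr_sum /q -natrM sum_code_sqr_symbol_count // !natrM natrD.
  case: strC => n2 _; have -> : n%:R = 1 + n.-1%:R :> R.
    by case: (n) n2 => // m _; rewrite -natr1 addrC.
  by ring.
have : \sum_(c in C) (q * M ^+ 2 - 2 * M * n%:R + Q c) <=
    \sum_(c in C) (q * M - n%:R) ^+ 2.
  apply: ler_sum => c cC; rewrite -gapE; apply: sum_gap_sqr_le => w.
  exact: leM.
rewrite big_split /= !sumr_const -[X in X + _]mulr_natl -[leRHS]mulr_natl.
have q_gt1 : 1 < q by rewrite ltr1n card_finNzRing_gt1.
have C_gt0 : 0 < #|C|%:R :> R by rewrite ltr0n card_gt0.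
have q_gt0 : 0 < q by apply: lt_trans q_gt1.
rewrite -(ler_pM2l q_gt0) mulrDr sumQ mulrCA -mulrDr [leRHS]mulrCA ler_pM2l //.
(* Multiplied by q, the averaged bound is q - 1 times the claim. *)
move=> bound; rewrite -subr_ge0 -(pmulr_rge0 _ (_ : 0 < q - 1)) ?subr_gt0 //.
rewrite -subr_ge0 in bound.
suff -> : (q - 1) * ((q * M - n%:R) ^+ 2 - n%:R) =
  q * (q * M - n%:R) ^+ 2 -
  (q * (q * M ^+ 2 - 2 * M * n%:R) + n%:R * (q + n%:R - 1)) by [].
by ring.
Qed.

Theorem theorem7 (R : rcfType) (q : nat) (F : finFieldType) (hq : #|F| = q)
    (n : nat) (C : {set 'rV[F]_n}) (C_nonempty : C != set0)
    (C_self_compl : self_complementary C) (C_strength : has_strength C 2) :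
  (covering_radius C)%:R
    <= (q%:R - 1) / q%:R * n%:R - Num.sqrt n%:R / q%:R :> R.
Proof.
have [|x radE] := bigop.eq_bigmax (dist_to_code C).
  by apply/card_gt0P; exists 0.
rewrite /covering_radius radE.
have [] := length_le_sqr_codist (R := R) C_nonempty C_self_compl C_strength
  (erefl (n%:R - (dist_to_code C x)%:R)).
rewrite hq; set r := (dist_to_code C x)%:R => gap_ge0 n_le.
have q_gt0 : 0 < q%:R :> R by rewrite -hq ltr0n; apply/card_gt0P; exists 0.
have : Num.sqrt n%:R <= q%:R * (n%:R - r) - n%:R.
  by rewrite -[leRHS]ger0_norm // -sqrtr_sqr ler_wsqrtr.
move=> sqrt_le; rewrite mulrAC -mulrBl ler_pdivlMr //; lra.
Qed.
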